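(* Let $\varphi\in\Gamma_0(\mathcal{X})$, let $x\in\mathcal{X}$, let $u^*\in\mathcal{X}^*$, and let $\gamma\in\,]0,+\infty[$. Then the following hold: (i) $\operatorname{prox}_{\gamma(\varphi-u^* )}x\neq\varnothing$. (ii) Let $z\in\operatorname{prox}_{\gamma(\varphi-u^* )}x$. Then $$L_\varphi(x,u^* )\geq H_{\partial\varphi}(x,u^* )\geq\frac{\|x-z\|^2}{\gamma}\geq\frac{1}{2}d^2_{\operatorname{gra}\partial\varphi,\gamma}(x,u^* ).$$ (iii) Suppose that $\mathcal{X}$ is strictly convex. Then $\operatorname{prox}_{\gamma(\varphi-u^* )}$ is single-valued and $$L_\varphi(x,u^* )\geq H_{\partial\varphi}(x,u^* )\geq\frac{\|x-\operatorname{prox}_{\gamma(\varphi-u^* )}x\|^2}{\gamma}\geq\frac{1}{2}d^2_{\operatorname{gra}\partial\varphi,\gamma}(x,u^* ).$$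
   Context: $\mathcal{X}\neq\{0\}$ is a reflexive real Banach space with topological dual $\mathcal{X}^*$, and $\langle\cdot,\cdot\rangle$ is the canonical duality pairing. $\Gamma_0(\mathcal{X})$ is the class of proper lower semicontinuous convex functions from $\mathcal{X}$ to $]-\infty,+\infty]$. For proper $\varphi\colon\mathcal{X}\to\,]-\infty,+\infty]$: the conjugate is $\varphi^*\colon x^*\mapsto\sup_{x\in\mathcal{X}}(\langle x,x^*\rangle-\varphi(x))$; the Fenchel--Young function is $L_\varphi\colon\mathcal{X}\times\mathcal{X}^*\to\,]-\infty,+\infty]\colon(x,u^* )\mapsto\varphi(x)+\varphi^*(u^* )-\langle x,u^*\rangle$; the subdifferential is $\partial\varphi\colon x\mapsto\{x^*\in\mathcal{X}^*\mid(\forall y\in\mathcal{X})\ \langle y-x,x^*\rangle+\varphi(x)\leq\varphi(y)\}$. For $u^*\in\mathcal{X}^*$, $\varphi-u^*$ denotes the function $y\mapsto\varphi(y)-\langle y,u^*\rangle$. The metric proximity operator of $\varphi\in\Gamma_0(\mathcal{X})$ is $\operatorname{prox}_\varphi\colon\mathcal{X}\to2^{\mathcal{X}}\colon x\mapsto\operatorname{Argmin}_{y\in\mathcal{X}}\big(\varphi(y)+\tfrac12\|x-y\|^2\big)$ (set of minimizers); when single-valued, $\operatorname{prox}_\varphi x$ also denotes its unique value. For $A\colon\mathcal{X}\to 2^{\mathcal{X}^*}$, $\operatorname{gra}A=\{(x,x^* )\mid x^*\in Ax\}$ and the Haraux function is $H_A\colon(x,u^* )\mapsto\sup_{(y,y^*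 )\in\operatorname{gra}A}\langle x-y,y^*-u^*\rangle$. For $\gamma\in\,]0,+\infty[$, set $|||(x,x^* )|||_\gamma=\sqrt{\|x\|^2/\gamma+\gamma\|x^*\|^2}$ for $(x,x^* )\in\mathcal{X}\times\mathcal{X}^*$, and for $\boldsymbol{C}\subset\mathcal{X}\times\mathcal{X}^*$ set $d_{\boldsymbol{C},\gamma}(x,x^* )=\inf_{(y,y^* )\in\boldsymbol{C}}|||(x,x^* )-(y,y^* )|||_\gamma\in[0,+\infty]$. *)

(* Defs.v *)
From HB Require Import structures.
From mathcomp Require Import all_boot all_order all_algebra.
From mathcomp Require Import all_classical all_reals all_analysis.

Set Implicit Arguments.
Unset Strict Implicit.
Unset Printing Implicit Defensive.

Import Order.TTheory GRing.Theory Num.Theory.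
Import numFieldNormedType.Exports.

Local Open Scope classical_set_scope.
Local Open Scope ring_scope.

Definition continuous_linear_pred (R : realType) (X : normedModType R) :
    {pred X -> R^o} :=
  [pred f | `[< linear f /\ continuous f >]].
Arguments continuous_linear_pred : clear implicits.

Lemma continuous_linear_submod (R : realType) (X : normedModType R) :
  submod_closed (continuous_linear_pred R X).
Proof.
split.
  apply/asboolP; split; first by move=> a x y; rewrite scaler0 addr0.
  by move=> x; exact: cvg_cst.
move=> a f g /asboolP[lf cf] /asboolP[lg cg]; apply/asboolP; split.
  move=> b x y.
  change (a *: f (b *: x + y) + g (b *: x + y) =
    b *: (a *: f x + g x) + (a *: f y + g y)).
  by rewrite lf lg !scalerDr !scalerA (mulrC a b) addrACA.
move=> x; change ((fun z => a *: f z + g z) @ x --> (a *: f x + g x)).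
by apply: cvgD; [apply: cvgZr; exact: cf|exact: cg].
Qed.

HB.instance Definition _ (R : realType) (X : normedModType R) :=
  GRing.isSubmodClosed.Build R (X -> R^o) (continuous_linear_pred R X)
    (continuous_linear_submod X).

(* The topological dual of X; the duality pairing <x, u> is the value u x. *)
Record dual (R : realType) (X : normedModType R) := Dual {
  dual_fun :> X -> R^o;
  dual_funP : dual_fun \in continuous_linear_pred R X }.

HB.instance Definition _ (R : realType) (X : normedModType R) :=
  [isSub of dual X for @dual_fun R X].
HB.instance Definition _ (R : realType) (X : normedModType R) :=
  [Choice of dual X by <:].
HB.instance Definition _ (R : realType) (X : normedModType R) :=
  [SubChoice_isSubLmodule of dual X by <:].

Section dual_norm.
Context {R : realType} {X : normedModType R}.
Implicit Types u v : dual X.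

Lemma dual_linear u : linear u.
Proof. by have /asboolP[] := dual_funP u. Qed.

HB.instance Definition _ u :=
  @GRing.isLinear.Build R X R^o *:%R (dual_fun u) (dual_linear u).

Lemma dual_continuous u : continuous u.
Proof. by have /asboolP[] := dual_funP u. Qed.

Definition dual_norm u : R := sup [set `|u x| | x in [set x : X | `|x| <= 1]].

Lemma dual_has_sup u : has_sup [set `|u x| | x in [set x : X | `|x| <= 1]].
Proof.
split; first by exists `|u 0|, 0 => //=; rewrite normr0.
have /linear_bounded_continuous/linear_boundedP := @dual_continuous u.
move=> /pinfty_ex_gt0[M M0 uM]; exists M => _ [x /= x1 <-].
by rewrite (le_trans (uM x))// ler_piMr// ltW.
Qed.

Lemma dual_norm_ge u (x : X) : `|x| <= 1 -> `|u x| <= dual_norm u.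
Proof. by move=> x1; apply: sup_upper_bound (dual_has_sup u) _ _; exists x. Qed.

Lemma dual_norm_le u (M : R) :
  (forall x : X, `|x| <= 1 -> `|u x| <= M) -> dual_norm u <= M.
Proof.
move=> uM; apply: ge_sup; first by case: (dual_has_sup u).
by move=> _ [x x1 <-]; exact: uM.
Qed.

Lemma dual_norm_ge0 u : 0 <= dual_norm u.
Proof. by apply: le_trans (dual_norm_ge u (x := 0) _); rewrite ?normr0. Qed.

Lemma dual_normD u v : dual_norm (u + v) <= dual_norm u + dual_norm v.
Proof.
apply: dual_norm_le => x x1; rewrite (le_trans (ler_normD (u x) (v x)))//.
by rewrite lerD// dual_norm_ge.
Qed.

Let dual_normZ_le (a : R) u : dual_norm (a *: u) <= `|a| * dual_norm u.
Proof.
apply: dual_norm_le => x x1; change (`|a * u x| <= `|a| * dual_norm u).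
by rewrite normrM ler_wpM2l// dual_norm_ge.
Qed.

Lemma dual_normZ (a : R) u : dual_norm (a *: u) = `|a| * dual_norm u.
Proof.
apply/eqP; rewrite eq_le dual_normZ_le/=.
have [->|a0] := eqVneq a 0; first by rewrite normr0 mul0r dual_norm_ge0.
rewrite -[u in leLHS](scalerK a0) (le_trans (ler_wpM2l _ (dual_normZ_le _ _)))//.
by rewrite mulrA -normrM divff// normr1 mul1r.
Qed.

Lemma dual_norm_eq0 u : dual_norm u = 0 -> u = 0.
Proof.
move=> u0; apply: val_inj; apply/funext => x /=; change (u x = 0).
have [->|x0] := eqVneq x 0; first by rewrite linear0.
have nx0 : `|x| != 0 by rewrite normr_eq0.
have : `|u (`|x|^-1 *: x)| <= dual_norm u.
  by rewrite dual_norm_ge// normrZ normfV normr_id mulVf.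
rewrite u0 normr_le0 linearZ/= scaler_eq0 invr_eq0 (negbTE nx0)/=.
by move/eqP.
Qed.

HB.instance Definition _ := Lmodule_isNormed.Build R (dual X)
  dual_normD dual_normZ dual_norm_eq0.

End dual_norm.

(* The canonical isometry of X into its bidual is onto. *)
Definition reflexive_space (R : realType) (X : normedModType R) : Prop :=
  forall F : dual (dual X), exists x : X, forall u : dual X, F u = u x.

Definition strictly_convex_space (R : realType) (X : normedModType R) : Prop :=
  forall x y : X, `|x| = 1 -> `|y| = 1 -> x != y -> `|2^-1 *: (x + y)| < 1.

Section convex_analysis.
Context {R : realType} {X : normedModType R}.
Local Open Scope ereal_scope.
Implicit Types (phi : X -> \bar R) (A : X -> set (dual X)).

(* Proper functions do not take the value -oo, so no sum below is of the form
   +oo + -oo for such functions. *)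
Definition proper phi : Prop :=
  (forall x, phi x != -oo) /\ (exists x, phi x != +oo).

Definition econvex phi : Prop :=
  forall (x y : X) (t : R), (0 < t < 1)%R ->
    phi (t *: x + (1 - t) *: y)%R <= t%:E * phi x + (1 - t)%:E * phi y.

Definition Gamma0 : set (X -> \bar R) :=
  [set phi | [/\ proper phi, lower_semicontinuous phi & econvex phi]].

Definition conjugate phi (u : dual X) : \bar R :=
  ereal_sup [set (u x)%:E - phi x | x in [set: X]].

Definition fenchel_young phi (x : X) (u : dual X) : \bar R :=
  phi x + conjugate phi u - (u x)%:E.

Definition subdifferential phi (x : X) : set (dual X) :=
  [set u | forall y : X, (u (y - x)%R)%:E + phi x <= phi y].

Definition tilt phi (u : dual X) (y : X) : \bar R := phi y - (u y)%:E.

Definition Argmin phi : set X := [set y | forall z, phi y <= phi z].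

Definition prox phi (x : X) : set X :=
  Argmin (fun y => phi y + (2^-1 * `|x - y| ^+ 2)%:E).

Definition gra A : set (X * dual X) := [set p | A p.1 p.2].

Definition haraux A (x : X) (u : dual X) : \bar R :=
  ereal_sup [set ((p.2 - u)%R (x - p.1)%R)%:E | p in gra A].

Definition pair_norm (gamma : R) (p : X * dual X) : R :=
  Num.sqrt (`|p.1| ^+ 2 / gamma + gamma * `|p.2| ^+ 2).

Definition pair_dist (C : set (X * dual X)) (gamma : R) (p : X * dual X) :
    \bar R :=
  ereal_inf [set (pair_norm gamma (p - q)%R)%:E | q in C].

Definition single_valued (P : X -> set X) : Prop :=
  forall x, exists! z, P x z.

(* The unique element of P x when P is single-valued. *)
Definition value_of (P : X -> set X) (x : X) : X := xget 0%R (P x).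

End convex_analysis.

(* Main.v *)
Require Import Defs.
From HB Require Import structures.
From mathcomp Require Import all_boot all_order all_algebra.
From mathcomp Require Import all_classical all_reals all_analysis.
From mathcomp Require Import ring lra.

(** The theorem rests on one separation result, [sandwich]: if g is convex
with values in ]-oo, +oo], h is a convex function with real values that is
bounded above on balls, and -h <= g, then some continuous affine function lies
between -h and g. It comes from [convex_hahn_banach], applied to the
inf-convolution w |-> inf_y (g y + h (y - w)), which is convex, finite and
nonnegative at 0. The proof uses [sandwich] in three ways.

With a cone h = k |x0 - .| - a, it shows that a function of Gamma_0 is the
supremum of its continuous affine minorants ([gamma0_minorant]): lower
semicontinuity gives phi > a near x0, and convexity spreads this to a conical
minorant on the whole space.

On the dual space, with g = phi^* and h(v) = gamma/2 |u - v|^2 - <x, v - u> + m,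
where -m is the value of the Fenchel dual problem, it yields a dual solution of
the dual problem, that is, an element of the bidual. Reflexivity makes it a
point z of X. Testing its inequality at the image of x - z under the duality
map, and using phi = phi^** in the form of [gamma0_minorant], shows that z
minimizes phi - u + |x - .|^2 / (2 gamma). This is the existence of a proximal
point ([quad_minimizer]), obtained without weak compactness.

At a proximal point z, with h the quadratic penalty, it yields v in the
subdifferential of phi at z with v - u a subgradient of |.|^2 / (2 gamma) at
x - z. Hence <x - z, v - u> >= |x - z|^2 / gamma and
|v - u| <= |x - z| / gamma ([minimizer_subgradient], [quad_subgradient]). The
point (z, v) of the graph then gives both lower bounds: it competes in the
supremum that defines the Haraux function, and its distance to (x, u) has
square at most 2 |x - z|^2 / gamma. The bound of the Haraux function by the
Fenchel-Young function is the subgradient inequality at (y, v) tested at x,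
and uniqueness in a strictly convex space is the midpoint argument. *)

Set Implicit Arguments.
Unset Strict Implicit.
Unset Printing Implicit Defensive.

Import Order.TTheory GRing.Theory Num.Theory.
Import numFieldNormedType.Exports.

Local Open Scope classical_set_scope.
Local Open Scope ring_scope.

(** * Linear minorants of convex functions *)

Section hahn_banach.
Context {R : realType} {V : lmodType R}.
Implicit Types (f p q : V -> R) (E : V -> set R).

Definition convex_fun f : Prop := forall (x y : V) (t : R), 0 <= t <= 1 ->
  f (t *: x + (1 - t) *: y) <= t * f x + (1 - t) * f y.

(** Convexity of the set of pairs (x, a) with E x a, up to decreasing values:
this is what the convexity of x |-> inf (E x) requires. The values at x of the
functions of a chain satisfy only this weak form: a barycentre of two values
need not be a value of a function of the chain. *)
Definition convex_fibers E : Prop := forall x y (a b t : R), 0 <= t <= 1 ->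
  E x a -> E y b ->
  exists2 c, E (t *: x + (1 - t) *: y) c & c <= t * a + (1 - t) * b.

Lemma half01 : 0 <= (2^-1 : R) <= 1.
Proof. by apply/andP; split; lra. Qed.

Lemma onem_half : 1 - 2^-1 = 2^-1 :> R.
Proof. by lra. Qed.

(** The infimum is finite because of the fiber at 0: 0 is the midpoint of x and
- x, so any b in E (- x) gives the lower bound - b for E x. *)
Lemma inf_convex_fibers E : (forall x, E x !=set0) -> lbound (E 0) 0 ->
  convex_fibers E ->
  [/\ convex_fun (fun x => inf (E x)), 0 <= inf (E 0) &
      forall x, lbound (E x) (inf (E x))].
Proof.
move=> Enz E0 Ecvx.
have Elb x : has_lbound (E x).
  have [b Eb] := Enz (- x); exists (- b) => a Ea.
  have [c + cab] := Ecvx _ _ _ _ _ half01 Ea Eb.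
  by rewrite onem_half -scalerDr subrr scaler0 => /E0 c0; lra.
split=> [x y t t01||x]; last 2 first.
- exact: lb_le_inf.
- exact: ge_inf.
rewrite leNgt; apply/negP => lt_inf.
set e := inf (E (t *: x + (1 - t) *: y)) - (t * inf (E x) + (1 - t) * inf (E y)).
have e0 : 0 < e by rewrite subr_gt0.
have [a Ea ae] := inf_adherent e0 (conj (Enz x) (Elb x)).
have [b Eb be] := inf_adherent e0 (conj (Enz y) (Elb y)).
have [c Ec cab] := Ecvx _ _ _ _ _ t01 Ea Eb.
have infc := ge_inf (Elb _) Ec.
move: t01 => /andP[t0 t1].
have ta : t * a + (1 - t) * b < t * (inf (E x) + e) + (1 - t) * (inf (E y) + e).
  have [->|tn0] := eqVneq t 0; first by lra.
  have : t * a < t * (inf (E x) + e) by rewrite ltr_pM2l// lt_neqAle eq_sym tn0.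
  have : (1 - t) * b <= (1 - t) * (inf (E y) + e).
    by rewrite ler_wpM2l ?subr_ge0// ltW.
  lra.
have eE : inf (E (t *: x + (1 - t) *: y)) =
  t * inf (E x) + (1 - t) * inf (E y) + e by rewrite /e; ring.
lra.
Qed.

(** If a is a slope with t a <= q (t y) for all t >= 0, then
x |-> inf_(t >= 0) (q (x + t y) - t a) is a convex minorant of q, nonnegative
at 0. By minimality it equals q, so q grows at least with slope a in the
direction y from every point, not only from 0. The largest such slope is
a y = inf_(t > 0) q (t y) / t; taking x = - y in the growth estimate
gives q (- y) <= - a y, and convexity at 0 gives - a (- y) <= a y.
Together these force a = q and q odd; the growth estimate then says that q is
superadditive, and oddness turns this into linearity. *)
Lemma minimal_convex_linear q : convex_fun q -> 0 <= q 0 ->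
  (forall r, convex_fun r -> 0 <= r 0 -> (forall x, r x <= q x) ->
    forall x, q x <= r x) ->
  linear (q : V -> R^o).
Proof.
move=> qcvx q0 qmin.
have q00 : q 0 = 0.
  apply/eqP; rewrite eq_le q0 andbT.
  have := qmin (fun x => q x - q 0) _ _ _ 0; rewrite subrr; apply => //.
  - by move=> x y t t01; have := qcvx x y t t01; lra.
  - by move=> x; rewrite gerBl.
(* The growth estimate, by comparing q with the infimum along the ray of
   direction y. *)
have slope_step y a : (forall t, 0 <= t -> t * a <= q (t *: y)) ->
    forall x t, 0 <= t -> q x + t * a <= q (x + t *: y).
  move=> ya x t t0.
  pose E x := [set q (x + s *: y) - s * a | s in [set s : R | 0 <= s]].
  have Ene z : E z !=set0 by exists (q (z + 0 *: y) - 0 * a); exists 0 => /=.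
  have E0 : lbound (E 0) 0.
    by move=> _ [s /= s0 <-]; rewrite add0r subr_ge0 ya.
  have Ecvx : convex_fibers E.
    move=> x1 x2 _ _ s s01 [t1 /= t10 <-] [t2 /= t20 <-].
    have /andP[s0 s1] := s01.
    exists (q (s *: (x1 + t1 *: y) + (1 - s) *: (x2 + t2 *: y))
             - (s * t1 + (1 - s) * t2) * a).
      exists (s * t1 + (1 - s) * t2).
        by rewrite /= addr_ge0// mulr_ge0// subr_ge0.
      by congr (q _ - _); rewrite (scalerDl y) !scalerDr !scalerA addrACA.
    by have := qcvx (x1 + t1 *: y) (x2 + t2 *: y) s s01; lra.
  have [rcvx r0 rlb] := inf_convex_fibers Ene E0 Ecvx.
  have rq z : inf (E z) <= q z.
    by apply: rlb; exists 0 => //=; rewrite scale0r mul0r addr0 subr0.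
  have qr := qmin _ rcvx r0 rq x.
  rewrite -lerBrDr (le_trans qr)//; apply: rlb; by exists t.
(* Convexity at 0, seen as a barycentre of t *: y and s *: - y. *)
have half_cone y t s : 0 < t -> 0 < s ->
    0 <= q (t *: y) / t + q (s *: - y) / s.
  move=> t0 s0; have ts0 : 0 < t + s by rewrite addr_gt0.
  have tsn0 : t + s != 0 by rewrite gt_eqF.
  have l01 : 0 <= s / (t + s) <= 1.
    by rewrite ler_pdivrMr// mul1r lerDr (ltW t0) divr_ge0// ltW.
  have lE : 1 - s / (t + s) = t / (t + s) by field.
  have := qcvx (t *: y) (s *: - y) _ l01.
  rewrite lE !scalerA scalerN -scalerBl.
  have -> : s / (t + s) * t - t / (t + s) * s = 0 by field.
  rewrite scale0r q00 => h.
  have -> : q (t *: y) / t + q (s *: - y) / s =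
    (s / (t + s) * q (t *: y) + t / (t + s) * q (s *: - y)) * ((t + s) / (t * s)).
    by field; rewrite ?tsn0 ?gt_eqF.
  by apply: mulr_ge0 => //; rewrite ltW// divr_gt0// mulr_gt0.
pose E y := [set q (t *: y) / t | t in [set t : R | 0 < t]].
pose a y := inf (E y).
have Ene y : E y !=set0 by exists (q (1 *: y) / 1); exists 1 => //=.
have Elb y : has_lbound (E y).
  exists (- (q (1 *: - y) / 1)) => _ [t /= t0 <-].
  by have := half_cone y t 1 t0 ltr01; lra.
have a_slope y t : 0 <= t -> t * a y <= q (t *: y).
  rewrite le_eqVlt => /predU1P[<-|t0]; first by rewrite mul0r scale0r q00.
  by rewrite mulrC -ler_pdivlMr//; apply: ge_inf; last by exists t.
have a_le y : a y <= q y by have := a_slope y 1 ler01; rewrite mul1r scale1r.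
have a_opp y : - a (- y) <= a y.
  apply: lb_le_inf => // _ [t /= t0 <-].
  rewrite lerNl; apply: lb_le_inf => // _ [s /= s0 <-].
  by have := half_cone y t s t0 s0; lra.
have q_opp y : q y <= - a (- y).
  have := slope_step _ _ (a_slope (- y)) y 1 ler01.
  by rewrite scale1r subrr q00; lra.
have aE y : a y = q y by have := a_le y; have := a_opp y; have := q_opp y; lra.
have qN y : q (- y) = - q y.
  by have := q_opp y; have := a_opp y; rewrite !aE; lra.
have superadd x y t : 0 <= t -> q x + t * q y <= q (x + t *: y).
  by move=> t0; rewrite -[q y]aE; apply: slope_step => // s; exact: a_slope.
have linp x y t : 0 <= t -> q (x + t *: y) = q x + t * q y.
  move=> t0; apply/eqP; rewrite eq_le superadd// andbT.
  by have := superadd (- x) (- y) t t0; rewrite scalerN -opprD !qN; lra.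
move=> t x y; change (q (t *: x + y) = t * q x + q y); rewrite [_ + y]addrC.
have [t0|t0] := leP 0 t; first by rewrite linp// addrC.
have -> : t *: x = (- t) *: (- x) by rewrite scaleNr scalerN opprK.
by rewrite linp ?oppr_ge0 1?ltW// qN mulrNN addrC.
Qed.

(** Zorn's lemma gives a minimal element among the convex minorants of p that
are nonnegative at 0; chains have a lower bound, their pointwise infimum.
Working with convex p, rather than sublinear p, is what makes the theorem
directly applicable to inf-convolutions. *)
Theorem convex_hahn_banach p : convex_fun p -> 0 <= p 0 ->
  exists2 l : V -> R^o, linear l & forall x, l x <= p x.
Proof.
move=> pcvx p0.
pose T := {q : V -> R | [/\ convex_fun q, 0 <= q 0 & forall x, q x <= p x]}.
pose below (f g : T) : bool := `[< forall x, sval g x <= sval f x >].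
have [||||q qmax] := @Zorn T below.
- by move=> f; apply/asboolP.
- move=> f g h /asboolP fg /asboolP gh; apply/asboolP => x.
  exact: le_trans (gh x) (fg x).
- move=> [f fP] [g gP] /asboolP fg /asboolP gf; apply: eq_exist.
  by apply/funext => x; apply/eqP; rewrite eq_le fg gf.
- move=> A Atot; have [A0|] := pselect (A !=set0); last first.
    move=> nA; exists (exist _ p (And3 pcvx p0 (fun x => lexx _))) => s As.
    by exfalso; apply: nA; exists s.
  pose E x := [set sval f x | f in A].
  have Ene x : E x !=set0 by have [f Af] := A0; exists (sval f x), f.
  have E0 : lbound (E 0) 0 by move=> _ [f _ <-]; case: (svalP f).
  have Ecvx : convex_fibers E.
    move=> x y _ _ t t01 [f Af <-] [g Ag <-]; have /andP[t0 t1] := t01.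
    have [/asboolP fg|/asboolP gf] := Atot f g Af Ag.
    + exists (sval g (t *: x + (1 - t) *: y)); first by exists g.
      have [gcvx _ _] := svalP g; rewrite (le_trans (gcvx _ _ _ t01))// lerD2r.
      by rewrite ler_wpM2l.
    + exists (sval f (t *: x + (1 - t) *: y)); first by exists f.
      have [fcvx _ _] := svalP f; rewrite (le_trans (fcvx _ _ _ t01))// lerD2l.
      by rewrite ler_wpM2l// subr_ge0.
  have [icvx i0 ilb] := inf_convex_fibers Ene E0 Ecvx.
  have ip x : inf (E x) <= p x.
    have [f Af] := A0; have [_ _ fp] := svalP f.
    by apply: le_trans (fp x); apply: ilb; exists f.
  exists (exist _ (fun x => inf (E x)) (And3 icvx i0 ip)) => f Af.
  by apply/asboolP => x /=; apply: ilb; exists f.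
have [qcvx q0 qp] := svalP q.
exists (sval q) => //; apply: minimal_convex_linear => // r rcvx r0 rq x.
have rp y : r y <= p y by exact: le_trans (rq y) (qp y).
have <- // : exist _ r (And3 rcvx r0 rp) = q.
by apply: qmax; apply/asboolP.
Qed.

End hahn_banach.

(** * Separation by a continuous affine function *)

Section sandwich.
Context {R : realType} {V : normedModType R}.
Implicit Types (g : V -> \bar R) (h : V -> R) (u v : dual V).

Lemma dual_le u (x : V) : `|u x| <= `|u| * `|x|.
Proof.
have [->|x0] := eqVneq x 0; first by rewrite linear0 !normr0 mulr0.
have nx0 : 0 < `|x| by rewrite normr_gt0.
have := dual_norm_ge u (x := `|x|^-1 *: x).
rewrite normrZ normfV normr_id mulVf ?gt_eqF// => /(_ (lexx _)).
by rewrite linearZ/= normrZ normfV normr_id mulrC ler_pdivrMr.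
Qed.

Lemma dualB u (x y : V) : u (x - y) = u x - u y :> R.
Proof. by rewrite linearB. Qed.

Lemma dual_subE u v (x : V) : (u - v) x = u x - v x :> R.
Proof. by []. Qed.

(** A one-sided bound suffices, since the unit ball is symmetric. *)
Lemma dual_of_linear (l : V -> R^o) (M : R) : linear l ->
  (forall x : V, `|x| <= 1 -> l x <= M) -> exists u, dual_fun u = l.
Proof.
move=> linl lM.
pose L : {linear V -> R^o} := HB.pack l
  (@GRing.isLinear.Build R V R^o *:%R l linl).
suff Lc : continuous L.
  have lP : l \in continuous_linear_pred R V by apply/asboolP.
  by exists (Dual lP).
apply/linear_bounded_continuous/ex_bound; exists M.
apply/nbhs_norm0P; exists 1 => //= x /= /ltW x1.
have lN : l (- x) = - l x := linearN L x.
by rewrite ler_norml lM// lerNl -lN lM ?normrN.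
Qed.

Lemma econvex_le g x y (a b t : R) : econvex g -> 0 <= t <= 1 ->
  (g x <= a%:E)%E -> (g y <= b%:E)%E ->
  (g (t *: x + (1 - t) *: y)%R <= (t * a + (1 - t) * b)%R%:E)%E.
Proof.
move=> gcvx /andP[t0 t1] gx gy.
have [->|tn0] := eqVneq t 0.
  by rewrite scale0r add0r subr0 scale1r mul0r add0r mul1r.
have [->|tn1] := eqVneq t 1.
  by rewrite subrr scale0r addr0 scale1r mul0r addr0 mul1r.
have tlt : 0 < t < 1 by rewrite !lt_neqAle t0 t1 tn1 eq_sym tn0.
rewrite (le_trans (gcvx x y t tlt))// (EFinD (t * a)) !EFinM leeD// lee_wpmul2l//.
by rewrite lee_fin subr_ge0.
Qed.

Definition bounded_above_on_balls h : Prop :=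
  forall r : R, exists M : R, forall x, `|x| <= r -> h x <= M.

(** A linear minorant l of the inf-convolution p w = inf_y (g y + h (y - w))
satisfies l (y - z) <= g y + h z, as one sees at w = y - z. It is continuous
because p is bounded above on the unit ball: for y0 in the domain of g,
p w <= g y0 + h (y0 - w). *)
Theorem sandwich g h : econvex g -> convex_fun h ->
  bounded_above_on_balls h -> (exists y, g y != +oo%E) ->
  (forall y, (- h y)%R%:E <= g y)%E ->
  exists u, forall y z, ((u (y - z) - h z)%R%:E <= g y)%E.
Proof.
move=> gcvx hcvx hbnd [y0 gy0] hg.
have gr y : g y != +oo%E -> exists r : R, g y = r%:E.
  by move: (hg y); case: (g y) => [r _ _|//|//]; exists r.
pose E w := [set yr.2 + h (yr.1 - w) | yr in
  [set yr : V * R | (g yr.1 <= yr.2%:E)%E]].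
have [r0 gy0E] := gr _ gy0.
have Ene w : E w !=set0.
  by exists (r0 + h (y0 - w)), (y0, r0) => //=; rewrite gy0E.
have E0 : lbound (E 0) 0.
  move=> _ [[y r] /= gyr <-]; rewrite subr0 -lerBlDr sub0r -lee_fin.
  exact: le_trans (hg y) gyr.
have Ecvx : convex_fibers E.
  move=> w1 w2 _ _ t t01 [[y1 r1] /= gy1 <-] [[y2 r2] /= gy2 <-].
  exists (t * r1 + (1 - t) * r2 + h (t *: (y1 - w1) + (1 - t) *: (y2 - w2))).
    exists (t *: y1 + (1 - t) *: y2, t * r1 + (1 - t) * r2) => /=.
      exact: econvex_le.
    by congr (_ + h _); rewrite !scalerBr opprD addrACA.
  by have := hcvx (y1 - w1) (y2 - w2) t t01; lra.
have [pcvx p0 plb] := inf_convex_fibers Ene E0 Ecvx.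
have [l linl lp] := convex_hahn_banach pcvx p0.
have lle w y r : (g y <= r%:E)%E -> l w <= r + h (y - w).
  by move=> gyr; apply: le_trans (lp w) _; apply: plb; exists (y, r).
have [M hM] := hbnd (`|y0| + 1).
have [|u uE] := @dual_of_linear l (r0 + M) linl.
  move=> x x1; apply: le_trans (lle x y0 r0 _) _; first by rewrite gy0E.
  by rewrite lerD2l hM// (le_trans (ler_normB _ _))// lerD2l.
exists u => y z; rewrite uE.
have [->|/gr[r gyE]] := eqVneq (g y) +oo%E; first by rewrite leey.
have := lle (y - z) y r; rewrite gyE lexx => /(_ isT).
by rewrite subKr lee_fin lerBlDr.
Qed.

End sandwich.

(** * Conical and quadratic penalties *)

Section penalties.
Context {R : realType} {V : normedModType R}.
Implicit Types (x y : V) (k c : R) (l : dual V).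

Lemma dist_convex x : convex_fun (fun y => `|x - y|).
Proof.
move=> y z t /andP[t0 t1].
have -> : x - (t *: y + (1 - t) *: z) = t *: (x - y) + (1 - t) *: (x - z).
  by rewrite !scalerBr addrACA -scalerDl [t + _]addrC subrK scale1r opprD.
rewrite (le_trans (ler_normD _ _))// !normrZ ger0_norm//.
by rewrite (@ger0_norm _ (1 - t)) ?subr_ge0.
Qed.

Lemma convex_fun_cone k c x : 0 <= k -> convex_fun (fun y => k * `|x - y| + c).
Proof.
move=> k0 y z t t01; have := ler_wpM2l k0 (dist_convex x y z t01); lra.
Qed.

Lemma bounded_above_cone k c x : 0 <= k ->
  bounded_above_on_balls (fun y => k * `|x - y| + c).
Proof.
move=> k0 r; exists (k * (`|x| + r) + c) => y yr; rewrite lerD2r ler_wpM2l//.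
by rewrite (le_trans (ler_normB _ _))// lerD2l.
Qed.

Definition quad k c x l y : R := k * `|x - y| ^+ 2 - l y + c.

Lemma convex_fun_quad k c x l : 0 <= k ->
  convex_fun (quad k c x l).
Proof.
move=> k0 y z t t01; have /andP[t0 t1] := t01; rewrite /quad.
have -> : l (t *: y + (1 - t) *: z) = t * l y + (1 - t) * l z :> R.
  by rewrite linearD !linearZ.
have := dist_convex x y z t01; set A := `|x - y|; set B := `|x - z|.
set C := `|_| => CAB.
have : C ^+ 2 <= t * A ^+ 2 + (1 - t) * B ^+ 2.
  have C0 : 0 <= C by exact: normr_ge0.
  have -> : t * A ^+ 2 + (1 - t) * B ^+ 2 =
    (t * A + (1 - t) * B) ^+ 2 + t * (1 - t) * (A - B) ^+ 2 by ring.
  apply: ler_wpDr.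
    by apply: mulr_ge0; [apply: mulr_ge0; rewrite ?subr_ge0|exact: sqr_ge0].
  by rewrite ler_sqr ?nnegrE// (le_trans C0).
by move=> /(ler_wpM2l k0); lra.
Qed.

Lemma bounded_above_quad k c x l : 0 <= k ->
  bounded_above_on_balls (quad k c x l).
Proof.
move=> k0 r; exists (k * (`|x| + r) ^+ 2 + `|l| * r + c) => y yr.
rewrite /quad lerD2r lerD//.
  rewrite ler_wpM2l// lerXn2r ?nnegrE// ?addr_ge0// ?(le_trans _ yr)//.
  by rewrite (le_trans (ler_normB _ _))// lerD2l.
rewrite (le_trans (ler_norm _))// normrN (le_trans (dual_le _ _))//.
by rewrite ler_wpM2l.
Qed.

End penalties.

(** * Affine minorants of functions in Gamma_0 *)

Section minorant.
Context {R : realType} {X : normedModType R}.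
Implicit Types (phi : X -> \bar R).

Lemma proper_finite phi : Defs.proper phi -> exists y r, phi y = r%:E.
Proof.
move=> [phiN [y phiy]]; exists y; move: (phiN y) phiy.
by case: (phi y) => [r _ _|//|//]; exists r.
Qed.

(** The sandwich between the cone and phi, read at the apex x0. *)
Lemma minorant_of_cone phi (a k : R) (x0 : X) : Defs.proper phi -> econvex phi ->
  0 <= k -> (forall y, (a - k * `|x0 - y|)%R%:E <= phi y)%E ->
  exists v : dual X, forall y, ((a + v (y - x0)%R)%R%:E <= phi y)%E.
Proof.
move=> [_ [y0 phiy0]] phicvx k0 phik.
have [||v vP] := sandwich phicvx (convex_fun_cone (- a) x0 k0)
  (bounded_above_cone (- a) x0 k0).
- by exists y0.
- by move=> y; rewrite opprD opprK addrC.
exists v => y; have := vP y x0.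
by rewrite subrr normr0 mulr0 add0r opprK addrC.
Qed.

Lemma lsc_ball phi (a : R) x0 : lower_semicontinuous phi -> (a%:E < phi x0)%E ->
  exists2 r : R, 0 < r & forall y, `|x0 - y| < r -> (a%:E < phi y)%E.
Proof.
move=> philsc /philsc[W /nbhs_normP[r /= r0 rW] Wa].
by exists r => // y xy; apply/Wa/rW.
Qed.

(** For y outside the ball where phi > a, the point of the segment [x0, y] at
distance r/2 from x0 satisfies phi > a, so convexity along the segment bounds
phi y from below by an affine function of |x0 - y|. This needs phi x0 to be
finite. *)
Lemma minorant_at_domain phi (a s : R) x0 : Gamma0 phi -> phi x0 = s%:E ->
  a < s ->
  exists v : dual X, forall y, ((a + v (y - x0)%R)%R%:E <= phi y)%E.
Proof.
move=> [phip philsc phicvx] phix0 as_.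
have [|r r0 ra] := @lsc_ball phi a x0 philsc; first by rewrite phix0 lte_fin.
(* A drop from s to a over the distance r / 2, the steepest descent that
   convexity allows while phi > a on the ball. *)
have k0 : 0 <= 2 * (s - a) / r by rewrite divr_ge0 ?ltW// mulr_gt0 ?subr_gt0.
apply: (minorant_of_cone phip phicvx k0) => y.
have [xyr|rxy] := ltP `|x0 - y| r.
  rewrite (le_trans _ (ltW (ra _ xyr)))// lee_fin gerBl.
  exact: mulr_ge0.
rewrite leNgt; apply/negP => /ltW phiy.
have d0 : 0 < `|x0 - y| by exact: lt_le_trans rxy.
(* With this t, the point t *: y + (1 - t) *: x0 is at distance r / 2 of x0. *)
pose t := r / (2 * `|x0 - y|).
have td : t * `|x0 - y| = r / 2 by rewrite /t; field; rewrite gt_eqF.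
have t0 : 0 < t by rewrite divr_gt0// mulr_gt0.
have t01 : 0 <= t <= 1.
  rewrite ltW//= ler_pdivrMr ?mulr_gt0// mul1r; lra.
have phix0le : (phi x0 <= s%:E)%E by rewrite phix0.
have := econvex_le phicvx t01 phiy phix0le; apply/negP; rewrite -ltNge.
apply: le_lt_trans (ra _ _).
  rewrite lee_fin.
  have -> : t * (a - 2 * (s - a) / r * `|x0 - y|) + (1 - t) * s =
    t * a - 2 * (s - a) / r * (t * `|x0 - y|) + (1 - t) * s by ring.
  rewrite td.
  have -> : 2 * (s - a) / r * (r / 2) = s - a by field; rewrite gt_eqF.
  have : 0 <= t * (s - a) by rewrite mulr_ge0// ltW// subr_gt0.
  lra.
have -> : x0 - (t *: y + (1 - t) *: x0) = t *: (x0 - y).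
  by rewrite scalerBl scale1r opprD opprB [x0 + _]addrC -addrA subrK addrC scalerBr.
by rewrite normrZ gtr0_norm// td; lra.
Qed.

(** When phi x0 is infinite, the segment argument fails; an affine minorant
built at a point of the domain then controls phi far from x0. *)
Theorem gamma0_minorant phi (a : R) x0 : Gamma0 phi -> (a%:E < phi x0)%E ->
  exists v : dual X, forall y, ((a + v (y - x0)%R)%R%:E <= phi y)%E.
Proof.
move=> phiG ax0; have [phip philsc phicvx] := phiG.
have [r r0 ra] := lsc_ball philsc ax0.
have [y0 [s0 phiy0]] := proper_finite phip.
have [|v0 v0P] := @minorant_at_domain phi (s0 - 1) s0 y0 phiG phiy0.
  by rewrite gtrBl.
pose c := s0 - 1 + v0 (x0 - y0).
(* The affine minorant from y0 has value c at x0 and decreases at rate at most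
   |v0|; at distance at least r from x0, the extra slope |a - c| / r absorbs
   the difference between a and c. *)
have k0 : 0 <= `|v0| + `|a - c| / r by rewrite addr_ge0// divr_ge0// ltW.
apply: (minorant_of_cone phip phicvx k0) => y.
have [xyr|rxy] := ltP `|x0 - y| r.
  by rewrite (le_trans _ (ltW (ra _ xyr)))// lee_fin gerBl mulr_ge0.
apply: le_trans (v0P y); rewrite lee_fin.
have acr : `|a - c| <= `|a - c| / r * `|x0 - y|.
  by rewrite -mulrA ler_peMr// ler_pdivlMl// mulr1.
have ac := ler_norm (a - c).
have vxy : - (`|v0| * `|x0 - y|) <= v0 (y - x0).
  by rewrite lerNl -linearN/= opprB (le_trans (ler_norm _)) ?dual_le.
have -> : v0 (y - y0) = v0 (x0 - y0) + v0 (y - x0).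
  by rewrite -linearD/= [_ + (y - x0)]addrC addrA subrK.
rewrite /c in acr ac *; lra.
Qed.

End minorant.

(** * Subgradients at a minimizer *)

Section optimality.
Context {R : realType} {X : normedModType R}.
Implicit Types (phi : X -> \bar R) (h : X -> R) (u v : dual X) (x z : X).

(** z minimizes phi + h, where s is the finite value phi z. Comparing with real
upper bounds r of phi y keeps the inequality inside R. *)
Definition minimizes phi h z (s : R) : Prop :=
  phi z = s%:E /\
  forall y (r : R), (phi y <= r%:E)%E -> s + h z <= r + h y.

(** The sum rule: v lies in the subdifferential of phi at z, and - v in that
of h. The minimality of z says that h, shifted by the minimal value, satisfies
the hypothesis of the sandwich, with contact at z. *)
Lemma minimizer_subgradient phi h z s : econvex phi -> convex_fun h ->
  bounded_above_on_balls h -> minimizes phi h z s ->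
  exists2 v, subdifferential phi z v & forall w, v (z - w) <= h w - h z.
Proof.
move=> phicvx hcvx hbnd [phiz zmin].
pose h' y := h y - (s + h z).
have h'cvx : convex_fun h'.
  by move=> y w t t01; have := hcvx y w t t01; rewrite /h'; lra.
have h'bnd : bounded_above_on_balls h'.
  move=> r; have [M hM] := hbnd r; exists (M - (s + h z)) => y yr.
  by rewrite lerD2r hM.
have [||v vP] := sandwich phicvx h'cvx h'bnd.
- by exists z; rewrite phiz.
- move=> y; case E : (phi y) => [r| |]; rewrite ?leey//.
    by rewrite lee_fin /h'; have := zmin y r; rewrite E lexx => /(_ isT); lra.
  exfalso; have := zmin y (s + h z - h y - 1); rewrite E => /(_ (leNye _)); lra.
exists v => [y|w].
  have := vP y z; rewrite /h' phiz -EFinD.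
  by have -> : v (y - z) - (h z - (s + h z)) = v (y - z) + s :> R by lra.
by have := vP z w; rewrite /h' phiz lee_fin; lra.
Qed.

Lemma le_vanishing_slack (a b c : R) : 0 <= c ->
  (forall t, 0 < t < 1 -> a <= b + t * c) -> a <= b.
Proof.
move=> c0 abc; rewrite leNgt; apply/negP => ba.
have d0 : 0 < a - b + c by lra.
have t0 : 0 < (a - b) / (2 * (a - b + c)).
  by rewrite divr_gt0 ?mulr_gt0// subr_gt0.
have /abc : 0 < (a - b) / (2 * (a - b + c)) < 1.
  by rewrite t0 ltr_pdivrMr ?mulr_gt0// mul1r; lra.
have : (a - b) / (2 * (a - b + c)) * c <= (a - b) / 2.
  have -> : (a - b) / 2 = (a - b) / (2 * (a - b + c)) * (a - b + c).
    by field; rewrite gt_eqF.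
  by rewrite ler_wpM2l ?(ltW t0)//; lra.
lra.
Qed.

(** The hypothesis says that v - u is a subgradient of |.|^2 / (2 gamma) at
x - z. The first bound is its directional derivative towards 0, the second one
compares it with the growth of the norm in every direction. *)
Lemma quad_subgradient (gamma : R) x z u v : 0 < gamma ->
  (forall w, v (z - w) <= quad (2 * gamma)^-1 0 x u w
                          - quad (2 * gamma)^-1 0 x u z) ->
  `|x - z| ^+ 2 / gamma <= (v - u) (x - z) /\ `|v - u| <= `|x - z| / gamma.
Proof.
move=> g0 vP; set e := x - z; set k := (2 * gamma)^-1.
have k0 : 0 <= k by rewrite invr_ge0 mulr_ge0// ltW.
have gE : gamma^-1 = 2 * k by rewrite /k; field; rewrite gt_eqF.
have {}vP d : (v - u) d <= k * (`|e + d| ^+ 2 - `|e| ^+ 2).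
  have := vP (z - d); rewrite /quad -/k -/e subKr opprB addrCA addrC -/e.
  have -> : u (z - d) = u z - u d :> R by rewrite linearB.
  by change ((v - u) d) with (v d - u d); lra.
have vuZ t y : (v - u) (t *: y) = t * (v - u) y :> R by rewrite linearZ.
rewrite gE; split.
  apply: (@le_vanishing_slack _ _ (k * `|e| ^+ 2)).
    by rewrite mulr_ge0// sqr_ge0.
  move=> t /andP[t0 t1].
  have := vP (- (t *: e)); rewrite -[in (v - u) _]scaleNr vuZ.
  have -> : e - t *: e = (1 - t) *: e by rewrite scalerBl scale1r.
  rewrite normrZ gtr0_norm ?subr_gt0// exprMn.
  by move=> h; rewrite -(ler_pM2l t0); lra.
apply: dual_norm_le => y y1.
have half (y' : X) : `|y'| <= 1 -> (v - u) y' <= `|e| * (2 * k).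
  move=> y'1; apply: (le_vanishing_slack k0) => t /andP[t0 _].
  have := vP (t *: y'); rewrite vuZ => h.
  have ety : `|e + t *: y'| <= `|e| + t.
    rewrite (le_trans (ler_normD _ _))// lerD2l normrZ gtr0_norm//.
    by rewrite ler_piMr// ltW.
  have : `|e + t *: y'| ^+ 2 <= (`|e| + t) ^+ 2.
    by rewrite ler_sqr ?nnegrE// addr_ge0// ltW.
  move=> /(ler_wpM2l k0) ety2.
  by rewrite -(ler_pM2l t0); lra.
rewrite ler_norml half// andbT lerNl -linearN/=.
by rewrite half// normrN.
Qed.

(** A norming functional is the subgradient met when minimizing the quadratic
penalty over the single point 0. *)
Lemma duality_map (gamma : R) (e : X) : 0 < gamma ->
  exists2 w : dual X, `|e| ^+ 2 / gamma <= w e & `|w| <= `|e| / gamma.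
Proof.
move=> g0.
pose phi y : \bar R := if y == 0 :> X then 0%E else +oo%E.
have phicvx : econvex phi.
  move=> y1 y2 t /andP[t0 t1]; rewrite /phi.
  have t10 : 0 < 1 - t by rewrite subr_gt0.
  have [->|_] := eqVneq y1 0; last first.
    rewrite gt0_muley ?lte_fin// addye ?leey//.
    by case: ifP => _; rewrite ?mule0// gt0_muley.
  have [->|_] := eqVneq y2 0; last by rewrite gt0_muley ?lte_fin// mule0 add0e leey.
  by rewrite !scaler0 addr0 eqxx !mule0 adde0.
have k0 : 0 <= (2 * gamma)^-1 by rewrite invr_ge0 mulr_ge0// ltW.
have [|v _ vP] := @minimizer_subgradient phi (quad (2 * gamma)^-1 0 e 0) 0 0
  phicvx (convex_fun_quad _ _ _ k0) (bounded_above_quad _ _ _ k0).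
  rewrite /minimizes /phi eqxx; split=> // y r.
  by case: eqP => [->|//]; rewrite lee_fin => r0; rewrite lerD2r.
by have [] := quad_subgradient g0 vP; rewrite !subr0; exists v.
Qed.

(** Dividing the proximal objective by gamma turns it into phi plus a quadratic
penalty; a minimizer has a finite value because phi is proper. *)
Lemma prox_minimizes phi (gamma : R) x u z : Defs.proper phi -> 0 < gamma ->
  prox (fun y => gamma%:E * tilt phi u y)%E x z <->
  exists s, minimizes phi (quad (2 * gamma)^-1 0 x u) z s.
Proof.
move=> phip g0; have [phiN _] := phip.
have objE y r : phi y = r%:E ->
    (gamma%:E * tilt phi u y + (2^-1 * `|x - y| ^+ 2)%:E)%E =
    (gamma * (r + quad (2 * gamma)^-1 0 x u y))%:E.
  move=> phiy; rewrite /tilt phiy -EFinB -EFinM -EFinD; congr EFin.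
  by rewrite /quad; field; rewrite gt_eqF.
have objoo y : phi y = +oo%E ->
    (gamma%:E * tilt phi u y + (2^-1 * `|x - y| ^+ 2)%:E)%E = +oo%E.
  by move=> phiy; rewrite /tilt phiy addye// gt0_muley ?lte_fin// addye.
split=> [zmin|[s [phiz zmin]] y].
  have [s phiz] : exists s, phi z = s%:E.
    have [y [r phiy]] := proper_finite phip.
    case E : (phi z) => [s| |]; first by exists s.
      by have := zmin y; rewrite (objE _ _ phiy) objoo.
    by have := phiN z; rewrite E.
  exists s; split=> // y r.
  case E : (phi y) => [r'|//|]; last by have := phiN y; rewrite E.
  rewrite lee_fin => r'r; have := zmin y.
  rewrite (objE _ _ phiz) (objE _ _ E) lee_fin ler_pM2l//.
  by move=> /le_trans; apply; rewrite lerD2r.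
case E : (phi y) => [r| |]; last by have := phiN y; rewrite E.
  by rewrite (objE _ _ phiz) (objE _ _ E) lee_fin ler_pM2l// zmin// E.
by rewrite (objoo _ E) leey.
Qed.

End optimality.

(** * Conjugates and existence of a minimizer *)

Section conjugation.
Context {R : realType} {X : normedModType R}.
Implicit Types (phi : X -> \bar R) (u v : dual X) (x z : X).

Lemma conjugate_le phi v (r : R) :
  (forall y, ((v y - r)%R%:E <= phi y)%E) -> (conjugate phi v <= r%:E)%E.
Proof.
move=> h; apply: ge_ereal_sup => _ [y _ <-]; have := h y.
case: (phi y) => [s| |]; rewrite ?addeNy ?leNye ?leeNy_eq//.
by rewrite -EFinB !lee_fin; lra.
Qed.

Lemma young phi v y (s r : R) : (phi y <= s%:E)%E ->
  (conjugate phi v <= r%:E)%E -> v y <= r + s.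
Proof.
move=> ys vr; rewrite -lerBlDr -lee_fin; apply: le_trans vr.
apply: (@le_trans _ _ ((v y)%:E - phi y)%E).
  by rewrite EFinB leeB.
by apply: ereal_sup_ubound; exists y.
Qed.

Lemma conjugate_convex phi : Defs.proper phi -> econvex (conjugate phi).
Proof.
move=> [phiN _] v w t /andP[t0 t1]; apply: ge_ereal_sup => _ [y _ <-].
case E : (phi y) => [r| |]; last by have := phiN y; rewrite E.
  have -> : (((t *: v + (1 - t) *: w) y)%:E - r%:E =
    t%:E * ((v y)%:E - r%:E) + (1 - t)%:E * ((w y)%:E - r%:E))%E.
    rewrite -!EFinB -!EFinM -EFinD; congr EFin.
    change (t * v y + (1 - t) * w y - r =
      t * (v y - r) + (1 - t) * (w y - r)).
    by ring.
  apply: leeD; apply: lee_wpmul2l;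
    rewrite ?lee_fin ?subr_ge0 ?(ltW t0) ?(ltW t1)//;
    by apply: ereal_sup_ubound; exists y; rewrite ?E.
by rewrite addeNy leNye.
Qed.

Lemma evaluation x : exists l : dual (dual X), forall v, l v = v x.
Proof.
have [||l lE] := @dual_of_linear R (dual X) (fun v => v x) `|x|.
- by move=> a v w.
- move=> v v1; rewrite (le_trans (ler_norm _))// (le_trans (dual_le _ _))//.
  by rewrite ler_piMl.
by exists l => v; rewrite lE.
Qed.

Lemma lte_EFin_between (a : R) (y : \bar R) : (a%:E < y)%E ->
  exists2 b : R, a < b & (b%:E < y)%E.
Proof.
case: y => [y||//]; last by exists (a + 1); rewrite ?ltrDl// ltry.
rewrite lte_fin => ay; exists ((a + y) / 2); rewrite ?lte_fin; lra.
Qed.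

(** Strong duality on the dual space. Weak duality [weak] bounds the dual
values by the primal ones, so that their supremum m is finite. The sandwich
between phi^* and the dual penalty gives an element of the bidual, hence, by
reflexivity, a point z; the sandwich inequality at u + w, with w dual to x - z,
reads <z, v> - phi^*(v) <= a for all v, where a + P z = m. Then phi z <= a,
because an affine minorant of phi whose value at z exceeds a would contradict
it. *)
Theorem quad_minimizer phi (gamma : R) x u : reflexive_space X ->
  Gamma0 phi -> 0 < gamma ->
  exists z s, minimizes phi (quad (2 * gamma)^-1 0 x u) z s.
Proof.
move=> Xrefl phiG g0; have [phip _ _] := phiG.
have [ev evE] := evaluation x.
set P := quad (2 * gamma)^-1 0 x u.
(* P is the primal penalty; k v = gamma/2 |u - v|^2 - <x, v> + <x, u> is the
   conjugate of P at - v, so that the dual problem is to minimize phi^* + k. *)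
pose k := quad (gamma / 2) (u x) u ev.
have weak y s v r : (phi y <= s%:E)%E -> (conjugate phi v <= r%:E)%E ->
    - (r + k v) <= s + P y.
  move=> ys vr; have vy := young ys vr.
  rewrite /P /k /quad evE.
  have uv : (v - u) (x - y) <= `|u - v| * `|x - y|.
    by rewrite distrC (le_trans (ler_norm _))// dual_le.
  have : `|u - v| * `|x - y| <=
      gamma / 2 * `|u - v| ^+ 2 + (2 * gamma)^-1 * `|x - y| ^+ 2.
    rewrite -subr_ge0.
    have -> : gamma / 2 * `|u - v| ^+ 2 + (2 * gamma)^-1 * `|x - y| ^+ 2
      - `|u - v| * `|x - y| =
      (2 * gamma)^-1 * (gamma * `|u - v| - `|x - y|) ^+ 2.
      by field; rewrite gt_eqF.
    by rewrite mulr_ge0 ?sqr_ge0// invr_ge0 mulr_ge0// ltW.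
  have : (v - u) (x - y) = v x - v y - u x + u y :> R.
    by rewrite dualB !dual_subE; ring.
  lra.
have [y0 [r0 phiy0]] := proper_finite phip.
have phiy0le : (phi y0 <= r0%:E)%E by rewrite phiy0.
pose S := [set - (vr.2 + k vr.1) | vr in
  [set vr : dual X * R | (conjugate phi vr.1 <= vr.2%:E)%E]].
have conjfin (a : R) w : (a%:E < phi w)%E ->
    exists v, (conjugate phi v <= (v w - a)%R%:E)%E.
  move=> /(gamma0_minorant phiG)[v vP]; exists v; apply: conjugate_le => y.
  rewrite (le_trans _ (vP y))// lee_fin dualB.
  by lra.
have [v1 v1fin] : exists v, (conjugate phi v <= (v y0 - (r0 - 1))%R%:E)%E.
  by apply: conjfin; rewrite phiy0 lte_fin gtrBl.
have Sne : S !=set0.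
  by exists (- (v1 y0 - (r0 - 1) + k v1)), (v1, v1 y0 - (r0 - 1)).
have Sub y s : (phi y <= s%:E)%E -> ubound S (s + P y).
  by move=> ys _ [[v r] /= vr <-]; exact: weak.
pose m := sup S.
have m_le y s : (phi y <= s%:E)%E -> m <= s + P y.
  by move=> /Sub; exact: ge_sup.
have le_m v r : (conjugate phi v <= r%:E)%E -> - (r + k v) <= m.
  move=> vr; apply: ub_le_sup; first by exists (r0 + P y0); exact: Sub.
  by exists (v, r).
have g20 : 0 <= gamma / 2 by rewrite divr_ge0// ltW.
pose h := quad (gamma / 2) (u x + m) u ev.
have [|v|F FP] := @sandwich R (dual X) (conjugate phi) h (conjugate_convex phip)
  (convex_fun_quad _ _ _ g20) (bounded_above_quad _ _ _ g20).
- by exists v1; rewrite -ltey (le_lt_trans v1fin)// ltry.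
- case E : (conjugate phi v) => [r| |]; rewrite ?leey//.
    rewrite lee_fin; have := le_m v r; rewrite E lexx => /(_ isT).
    by rewrite /h /k /quad; lra.
  (* The conjugate is never - oo: its values dominate those of an affine function
     at the point y0 of the domain of phi. *)
  exfalso; have := young phiy0le (r := v y0 - r0 - 1) (v := v); rewrite E leNye.
  by move=> /(_ isT); lra.
have [z FE] := Xrefl F.
have [w we wn] := duality_map (x - z) g0.
pose a := m - P z.
have wn2 : gamma / 2 * `|w| ^+ 2 <= (2 * gamma)^-1 * `|x - z| ^+ 2.
  have -> : (2 * gamma)^-1 * `|x - z| ^+ 2 =
     gamma / 2 * (`|x - z| / gamma) ^+ 2 by field; rewrite gt_eqF.
  by rewrite ler_wpM2l// ler_sqr ?nnegrE// divr_ge0// ltW.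
have gE : `|x - z| ^+ 2 / gamma = 2 * ((2 * gamma)^-1 * `|x - z| ^+ 2).
  by field; rewrite gt_eqF.
have conj_ge v : ((v z - a)%R%:E <= conjugate phi v)%E.
  apply: le_trans (FP v (u + w)); rewrite lee_fin FE /h /quad evE.
  have -> : u - (u + w) = - w by rewrite opprD addrA subrr sub0r.
  rewrite normrN /a /P /quad.
  have -> : (v - (u + w)) z = v z - (u z + w z) :> R by [].
  have -> : (u + w) x = u x + w x :> R by [].
  by move: we; rewrite dualB gE; lra.
have phiz : (phi z <= a%:E)%E.
  rewrite leNgt; apply/negP => /lte_EFin_between[b ab /conjfin[v vP]].
  by have := le_trans (conj_ge v) vP; rewrite lee_fin; lra.
case E : (phi z) => [s| |]; last by have [phiN _] := phip; have := phiN z; rewrite E.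
  exists z, s; split=> // y r phiy; have := m_le _ _ phiy.
  by move: phiz; rewrite E lee_fin /a; lra.
by move: phiz; rewrite E.
Qed.

End conjugation.

(** * Uniqueness in strictly convex spaces *)

Section uniqueness.
Context {R : realType} {X : normedModType R}.
Implicit Types (phi : X -> \bar R) (u : dual X) (x y z : X).

Lemma strictly_convex_midpoint x y (r : R) : strictly_convex_space X ->
  `|x| = r -> `|y| = r -> x != y -> `|2^-1 *: (x + y)| < r.
Proof.
move=> Xsc xr yr xy.
have r0 : 0 < r.
  rewrite lt_neqAle -{2}xr normr_ge0 andbT; apply/eqP => r0.
  move: xy; rewrite (normr0_eq0 (etrans xr (esym r0))).
  by rewrite (normr0_eq0 (etrans yr (esym r0))) eqxx.
have rn0 : r^-1 != 0 by rewrite invr_eq0 gt_eqF.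
have unit (w : X) : `|w| = r -> `|r^-1 *: w| = 1.
  by move=> wr; rewrite normrZ wr gtr0_norm ?invr_gt0// mulVf// gt_eqF.
have := Xsc (r^-1 *: x) (r^-1 *: y) (unit _ xr) (unit _ yr).
rewrite (inj_eq (scalerI rn0)) => /(_ xy).
rewrite -scalerDr scalerA mulrC -scalerA normrZ gtr0_norm ?invr_gt0//.
by rewrite mulrC ltr_pdivrMr// mul1r.
Qed.

(** The objective at the midpoint of two minimizers is strictly smaller: if
x - z1 and x - z2 have different norms, by strict convexity of the square; if
they have equal norms, by strict convexity of the norm. *)
Lemma quad_minimizer_unique phi (gamma : R) x u z1 z2 s1 s2 :
  strictly_convex_space X -> econvex phi -> 0 < gamma ->
  minimizes phi (quad (2 * gamma)^-1 0 x u) z1 s1 ->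
  minimizes phi (quad (2 * gamma)^-1 0 x u) z2 s2 -> z1 = z2.
Proof.
move=> Xsc phicvx g0 [phiz1 min1] [phiz2 min2].
apply/eqP/negPn/negP => z12.
have k0 : 0 < (2 * gamma)^-1 by rewrite invr_gt0 mulr_gt0.
have le1 : (phi z1 <= s1%:E)%E by rewrite phiz1.
have le2 : (phi z2 <= s2%:E)%E by rewrite phiz2.
have := econvex_le phicvx half01 le1 le2; rewrite onem_half -scalerDr => lem.
have := min1 _ _ lem; have := min1 _ _ le2; have := min2 _ _ le1.
rewrite /quad; set p := 2^-1 *: (z1 + z2).
have -> : u p = 2^-1 * (u z1 + u z2) :> R by rewrite /p linearZ linearD.
have pE : x - p = 2^-1 *: ((x - z1) + (x - z2)).
  rewrite /p addrACA -opprD scalerBr; congr (_ - _).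
  by rewrite scalerDr -scalerDl -[LHS]scale1r; congr (_ *: _); lra.
have ab : `|x - p| <= 2^-1 * (`|x - z1| + `|x - z2|).
  by rewrite pE normrZ gtr0_norm ?invr_gt0// ler_wpM2l ?ler_normD.
have x12 : x - z1 != x - z2 by rewrite (inj_eq (addrI x)) eqr_opp.
have strict : `|x - z1| = `|x - z2| -> `|x - p| < `|x - z2|.
  by move=> eq12; rewrite pE strictly_convex_midpoint.
have : 2 * `|x - p| ^+ 2 < `|x - z1| ^+ 2 + `|x - z2| ^+ 2.
  move: ab strict (normr_ge0 (x - p)).
  set a := `|x - z1|; set b := `|x - z2|; set c := `|x - p| => cab str c0.
  have [ab|ab] := eqVneq a b.
    by rewrite ab; have := str ab => cb; nra.
  have : 0 < (a - b) ^+ 2 by rewrite exprn_even_gt0//= subr_eq0.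
  have : c ^+ 2 <= (2^-1 * (a + b)) ^+ 2 by rewrite ler_sqr ?nnegrE// (le_trans c0).
  lra.
move=> /[dup]; rewrite -(ltr_pM2l k0); lra.
Qed.

End uniqueness.

(** * Bounds for the Haraux function and the distance to the graph *)

Section inequalities.
Context {R : realType} {X : normedModType R}.
Implicit Types (phi : X -> \bar R) (u v : dual X) (x z : X).
Local Open Scope ereal_scope.

(** A graph point (y, v) satisfies <x - y, v> + phi y <= phi x, and
<y, u> - phi y <= phi^*(u) by definition of the conjugate. *)
Lemma haraux_le_fenchel_young phi x u : Defs.proper phi ->
  haraux (subdifferential phi) x u <= fenchel_young phi x u.
Proof.
move=> [phiN [y0 phiy0]]; apply: ge_ereal_sup => _ [[y v] vy <-].
rewrite [((y, v).2 - u)%R _]dual_subE.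
have := vy y0; have := vy x.
case Ey : (phi y) => [r| |]; last by have := phiN y; rewrite Ey.
  move=> vx _; rewrite /fenchel_young.
  have ur : (u y)%:E - r%:E <= conjugate phi u.
    by rewrite -Ey; apply: ereal_sup_ubound; exists y.
  rewrite leeBrDr//; apply: le_trans (leeD vx ur).
  by rewrite -!EFinD lee_fin (dualB u); lra.
by move=> _; rewrite addey// leye_eq (negbTE phiy0).
Qed.

Lemma haraux_ge phi x u z v (r : R) : subdifferential phi z v ->
  (r <= (v - u) (x - z))%R -> r%:E <= haraux (subdifferential phi) x u.
Proof.
move=> vz rv; apply: le_trans (ereal_sup_ubound _); last by exists (z, v).
by rewrite lee_fin.
Qed.

Lemma dist_graph_le phi x u z v (gamma : R) : (0 < gamma)%R ->
  subdifferential phi z v -> (`|v - u| <= `|x - z| / gamma)%R ->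
  2^-1%:E * pair_dist (gra (subdifferential phi)) gamma (x, u) ^+ 2 <=
  (`|x - z| ^+ 2 / gamma)%:E.
Proof.
move=> g0 vz vu.
set d := pair_dist _ _ _; pose s := pair_norm gamma ((x, u) - (z, v))%R.
have d0 : 0 <= d.
  by apply: le_ereal_inf_tmp => _ [q _ <-]; rewrite lee_fin sqrtr_ge0.
have ds : d <= s%:E by apply: ereal_inf_lbound; exists (z, v).
have s2 : (s ^+ 2 <= 2 * (`|x - z| ^+ 2 / gamma))%R.
  rewrite /s /pair_norm sqr_sqrtr/=; last first.
    by rewrite addr_ge0 ?divr_ge0 ?mulr_ge0 ?sqr_ge0// ltW.
  have : (gamma * `|u - v| ^+ 2 <= `|x - z| ^+ 2 / gamma)%R.
    have -> : (`|x - z| ^+ 2 / gamma = gamma * (`|x - z| / gamma) ^+ 2)%R.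
      by field; rewrite gt_eqF.
    rewrite ler_wpM2l ?(ltW g0)// distrC ler_sqr ?nnegrE// divr_ge0//.
    exact: ltW.
  lra.
apply: (@le_trans _ _ (2^-1%:E * (s%:E * s%:E))).
  by rewrite lee_wpmul2l// expe2 lee_pmul.
by rewrite -!EFinM lee_fin -expr2; lra.
Qed.

End inequalities.

Section prox_bounds.
Context {R : realType} {X : normedModType R}.
Local Open Scope ereal_scope.

Lemma prox_bounds (phi : X -> \bar R) (x z : X) (u : dual X) (gamma : R) :
  Defs.proper phi -> econvex phi -> (0 < gamma)%R ->
  prox (fun y => gamma%:E * tilt phi u y) x z ->
  (`|x - z| ^+ 2 / gamma)%:E <= haraux (subdifferential phi) x u /\
  2^-1%:E * pair_dist (gra (subdifferential phi)) gamma (x, u) ^+ 2 <=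
    (`|x - z| ^+ 2 / gamma)%:E.
Proof.
move=> phip phicvx g0 /(prox_minimizes x u z phip g0)[s zmin].
have k0 : (0 <= (2 * gamma)^-1)%R by rewrite invr_ge0 mulr_ge0// ltW.
have [v vz /(quad_subgradient g0)[vge vle]] := minimizer_subgradient phicvx
  (convex_fun_quad _ _ _ k0) (bounded_above_quad _ _ _ k0) zmin.
by split; [exact: haraux_ge vge|exact: dist_graph_le vle].
Qed.

End prox_bounds.

Local Open Scope ereal_scope.

Theorem theorem4p4 (R : realType) (X : completeNormedModType R)
    (X_neq0 : exists x : X, x != 0%R) (X_reflexive : reflexive_space X)
    (phi : X -> \bar R) (phi_Gamma0 : Gamma0 phi)
    (x : X) (u : dual X) (gamma : R) (gamma_gt0 : (0 < gamma)%R) :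
  let P := prox (fun y => gamma%:E * tilt phi u y) in
  [/\ P x !=set0,
      forall z : X, P x z ->
        [/\ fenchel_young phi x u >= haraux (subdifferential phi) x u,
            haraux (subdifferential phi) x u >= (`|x - z| ^+ 2 / gamma)%:E &
            (`|x - z| ^+ 2 / gamma)%:E >=
              2^-1%:E * pair_dist (gra (subdifferential phi)) gamma (x, u) ^+ 2]
    & strictly_convex_space X ->
        single_valued P /\
        [/\ fenchel_young phi x u >= haraux (subdifferential phi) x u,
            haraux (subdifferential phi) x u >=
              (`|x - value_of P x| ^+ 2 / gamma)%:E &
            (`|x - value_of P x| ^+ 2 / gamma)%:E >=
              2^-1%:E * pair_dist (gra (subdifferential phi)) gamma (x, u) ^+ 2]].
Proof.
have [phip philsc phicvx] := phi_Gamma0; move=> P.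
have bounds z : P x z ->
    [/\ fenchel_young phi x u >= haraux (subdifferential phi) x u,
        haraux (subdifferential phi) x u >= (`|x - z| ^+ 2 / gamma)%:E &
        (`|x - z| ^+ 2 / gamma)%:E >=
          2^-1%:E * pair_dist (gra (subdifferential phi)) gamma (x, u) ^+ 2].
  move=> /(prox_bounds phip phicvx gamma_gt0)[haraux_z dist_z].
  by split=> //; exact: haraux_le_fenchel_young.
have P_nonempty x' : P x' !=set0.
  have [z [s zmin]] := quad_minimizer x' u X_reflexive phi_Gamma0 gamma_gt0.
  by exists z; apply/prox_minimizes => //; exists s.
split=> // X_sc; split; last first.
  by apply: bounds; rewrite /value_of; exact: xgetPex (P_nonempty x).
move=> x'; have [z Pz] := P_nonempty x'; exists z; split=> // z' Pz'.
have [s zmin] := (prox_minimizes x' u z phip gamma_gt0).1 Pz.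
have [s' z'min] := (prox_minimizes x' u z' phip gamma_gt0).1 Pz'.
exact: quad_minimizer_unique X_sc phicvx gamma_gt0 zmin z'min.
Qed.
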